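(* Let $d\ge 1$, let $\ell\in\{0,1,\ldots,d\}$, let $\boldsymbol{x}=(x_1,\ldots,x_d)^\top\in[0,\infty)^d$ be the target vector and let $\mathbf{h}=(h_1,\ldots,h_d)^\top$ be a vector of bandwidths with $h_j>0$, $j=1,\ldots,d$. Then the multiple combined gamma kernel $$\mathbf{G}_{\boldsymbol{x},\mathbf{h};\ell}(\mathbf{u})=\Bigl(\prod_{s=1}^{d-\ell}G_{x_s,h_s}(u_s)\Bigr)\Bigl(\prod_{r=d-\ell+1}^{d}G_{\rho(x_r;h_r),h_r}(u_r)\Bigr),\qquad \mathbf{u}=(u_1,\ldots,u_d)^\top,$$ is a multivariate associated kernel on the support $\mathbb{S}_{\boldsymbol{x},\mathbf{h}}=[0,\infty)^d$, whose random vector has mean vector $\boldsymbol{x}+\mathbf{A}(\boldsymbol{x},\mathbf{h})=(x_1+a_1(x_1,h_1),\ldots,x_d+a_d(x_d,h_d))^\top$ and covariance matrix $\mathbf{B}(\boldsymbol{x},\mathbf{h})=\mathbf{diag}(b_{jj}(x_j,h_j))_{j=1,\ldots,d}$. In particular, writing, for $j=1,\ldots,d$, $$\widetilde a_j(x_j,h_j)=\frac{x_j^2+4h_j(h_j-x_j)}{4h_j}\,1_{[0,2h_j)}(x_j),\qquad \widetilde b_j(x_j,h_j)=\begin{cases}(x_j^2+4h_j^2)/4 & \text{if } x_j\in[0,2h_j],\\ x_jh_j & \text{if } x_j\in(2h_j,\infty),\end{cases}$$ one has: (i) if $\ell=0$ (multiple standard gamma kernel), $\mathbf{A}(\boldsymbol{x},\mathbf{h})=(h_1,\ldots,h_d)^\top$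 and $\mathbf{B}(\boldsymbol{x},\mathbf{h})=\mathbf{diag}(h_j(x_j+h_j))_{j=1,\ldots,d}$; (ii) if $\ell=d$ (multiple modified gamma kernel), $\mathbf{A}(\boldsymbol{x},\mathbf{h})=(\widetilde a_1(x_1,h_1),\ldots,\widetilde a_d(x_d,h_d))^\top$ and $\mathbf{B}(\boldsymbol{x},\mathbf{h})=\mathbf{diag}(\widetilde b_j(x_j,h_j))_{j=1,\ldots,d}$; (iii) if $\ell\in\{1,\ldots,d-1\}$ (multiple combined gamma kernel), $\mathbf{A}(\boldsymbol{x},\mathbf{h})=(h_1,\ldots,h_{d-\ell},\widetilde a_{d-\ell+1}(x_{d-\ell+1},h_{d-\ell+1}),\ldots,\widetilde a_d(x_d,h_d))^\top$ and $\mathbf{B}(\boldsymbol{x},\mathbf{h})=\mathbf{diag}\bigl(h_1(x_1+h_1),\ldots,h_{d-\ell}(x_{d-\ell}+h_{d-\ell}),\widetilde b_{d-\ell+1}(x_{d-\ell+1},h_{d-\ell+1}),\ldots,\widetilde b_d(x_d,h_d)\bigr)$.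
   Context: For $x\ge 0$ and $h>0$, the standard and modified univariate gamma kernels are the probability densities on $[0,\infty)$ $$G_{x,h}(u)=\frac{u^{x/h}e^{-u/h}}{\Gamma(1+x/h)\,h^{1+x/h}}1_{[0,\infty)}(u),\qquad G_{\rho(x;h),h}(u)=\frac{u^{\rho(x;h)-1}e^{-u/h}}{\Gamma(\rho(x;h))\,h^{\rho(x;h)}}1_{[0,\infty)}(u),$$ where $\rho(x;h)=1+(x/2h)^2$ (that is, $1+(x/(2h))^2$) if $x\in[0,2h)$ and $\rho(x;h)=x/h$ if $x\in[2h,\infty)$, and $\Gamma$ is the gamma function. Empty products equal $1$. An associated kernel's ''random vector'' is a random vector having the kernel as its probability density function. Multivariate associated kernel (here with support of the target density equal to $[0,\infty)^d$): a family of probability density functions $K_{\boldsymbol{x},\mathbf{h}}$ on supports $\mathbb{S}_{\boldsymbol{x},\mathbf{h}}$, indexed by $\boldsymbol{x}\in[0,\infty)^d$ and $\mathbf{h}\in(0,\infty)^d$, such that $\boldsymbol{x}\in\mathbb{S}_{\boldsymbol{x},\mathbf{h}}$ and a random vector with density $K_{\boldsymbol{x},\mathbf{h}}$ has mean $\boldsymbol{x}+\mathbf{A}(\boldsymbol{x},\mathbf{h})$ and covariance matrix $\mathbf{B}(\boldsymbol{x},\mathbf{h})$, where, for each fixed $\boldsymbol{x}$, $\mathbf{A}(\boldsymbol{x},\mathbf{h})\to\mathbf{0}$ (null vector) and $\mathbf{B}(\boldsymbol{x},\mathbf{h})\to\mathbf{0}$ (null matrix) as $\mathbf{h}\to\mathbf{0}$.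 *)

(* Defs.v *)
From HB Require Import structures.
From mathcomp Require Import all_boot all_order all_algebra.
From mathcomp Require Import all_classical all_reals all_analysis.

Set Implicit Arguments.
Unset Strict Implicit.
Unset Printing Implicit Defensive.

Import Order.TTheory GRing.Theory Num.Theory.
Import numFieldNormedType.Exports.

Local Open Scope classical_set_scope.
Local Open Scope ring_scope.

Definition colvec_display : measure_display -> measure_display.
Proof. exact. Qed.

(* Column vectors carry the product sigma-algebra, which is the smallest one
   that makes all coordinates measurable. *)
Section measurable_colvec.
Context {disp} {T : sigmaRingType disp} (n : nat).

Let coords : 'I_n -> 'cV[T]_n -> T := fun i u => u i ord0.

Let colvec_set0 : g_sigma_preimage coords set0.
Proof. exact: sigma_algebra0. Qed.

Let colvec_setC A : g_sigma_preimage coords A -> g_sigma_preimage coords (~` A).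
Proof. exact: sigma_algebraC. Qed.

Let colvec_bigcup (F : (set 'cV[T]_n)^nat) :
  (forall i, g_sigma_preimage coords (F i)) ->
  g_sigma_preimage coords (\bigcup_i (F i)).
Proof. exact: sigma_algebra_bigcup. Qed.

HB.instance Definition _ := @isMeasurable.Build (colvec_display disp)
  'cV[T]_n (g_sigma_preimage coords) colvec_set0 colvec_setC colvec_bigcup.

End measurable_colvec.

Section lebesgue_colvec.
Context {R : realType}.
Implicit Type n : nat.

(* Lebesgue measure on ['cV[R]_n] is built by induction on [n], as the image of a
   binary product measure under prepending a coordinate. *)
Definition cons_colvec n (p : measurableTypeR R * 'cV[R]_n) : 'cV[R]_n.+1 :=
  col_mx (p.1 : R)%:M p.2.

Lemma measurable_coord n (i : 'I_n) :
  measurable_fun [set: 'cV[R]_n] (fun u : 'cV[R]_n => u i ord0).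
Proof.
move=> _ Y mY; rewrite setTI; apply: sub_sigma_algebra => /=.
rewrite -bigcup_seq/=; exists i => /=; first by rewrite mem_index_enum.
by exists Y => //; rewrite setTI.
Qed.

Lemma measurable_fun_colvec {d} {T : measurableType d} n (f : T -> 'cV[R]_n) :
  (forall i, measurable_fun setT (fun t => f t i ord0)) -> measurable_fun setT f.
Proof.
move=> mf; apply: (@measurability _ _ _ _ _ _
  (\big[setU/set0]_(i < n)
    preimage_set_system setT (fun u : 'cV[R]_n => u i ord0) measurable)).
  by [].
move=> _ [B + <-]; rewrite -bigcup_seq => -[i _ [A mA <-]].
by rewrite setTI -comp_preimage; apply: mf.
Qed.

Lemma cons_colvec0 n p : @cons_colvec n p ord0 ord0 = p.1.
Proof.
rewrite /cons_colvec (_ : ord0 = lshift n (ord0 : 'I_1)); last exact/val_inj.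
by rewrite (@col_mxEu R 1 n 1) mxE eqxx mulr1n.
Qed.

Lemma cons_colvecS n p (i : 'I_n) :
  @cons_colvec n p (lift ord0 i) ord0 = p.2 i ord0.
Proof.
rewrite /cons_colvec (_ : lift ord0 i = rshift 1 i); last exact/val_inj.
by rewrite (@col_mxEd R 1 n 1).
Qed.

Lemma measurable_cons_colvec n : measurable_fun setT (@cons_colvec n).
Proof.
apply: measurable_fun_colvec => i; have [j ->|->] := unliftP ord0 i.
- rewrite (_ : (fun _ => _) = (fun u : 'cV[R]_n => u j ord0) \o snd).
    exact: (measurableT_comp (measurable_coord j) measurable_snd).
  by apply/funext => p /=; rewrite cons_colvecS.
- rewrite (_ : (fun _ => _) = fst); first exact: measurable_fst.
  by apply/funext => p /=; rewrite cons_colvec0.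
Qed.

Section cons_measure.
Variables (n : nat) (mu : {sigma_finite_measure set 'cV[R]_n -> \bar R}).

Definition cons_measure : set 'cV[R]_n.+1 -> \bar R :=
  pushforward (lebesgue_measure \x mu)%E (@cons_colvec n).


Let measurable_preimage_cons A :
  measurable A -> measurable (@cons_colvec n @^-1` A).
Proof.
by move=> mA; rewrite -[X in measurable X]setTI; apply: measurable_cons_colvec.
Qed.

Let cons_measure0 : cons_measure set0 = 0%E.
Proof. by rewrite /cons_measure /pushforward preimage_set0 measure0. Qed.

Let cons_measure_ge0 A : (0 <= cons_measure A)%E.
Proof. by rewrite /cons_measure /pushforward; apply: measure_ge0. Qed.

Let cons_measure_sigma_additive : semi_sigma_additive cons_measure.
Proof.
move=> F mF tF mUF; rewrite /cons_measure /pushforward preimage_bigcup.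
apply: measure_semi_sigma_additive.
- by move=> k; exact: measurable_preimage_cons.
- apply/trivIsetP => /= i j _ _ ij; rewrite -preimage_setI.
  by move/trivIsetP : tF => /(_ _ _ _ _ ij) ->//; rewrite preimage_set0.
- by rewrite -preimage_bigcup; exact: measurable_preimage_cons.
Qed.

HB.instance Definition _ := isMeasure.Build _ _ _ cons_measure
  cons_measure0 cons_measure_ge0 cons_measure_sigma_additive.

Lemma cons_measureX (A : set (measurableTypeR R)) (B : set 'cV[R]_n) :
  measurable A -> measurable B ->
  cons_measure
    [set u : 'cV[R]_n.+1 | A (u ord0 ord0) /\ B (\col_i u (lift ord0 i) ord0)]
    = (lebesgue_measure A * mu B)%E.
Proof.
move=> mA mB.
transitivity ((lebesgue_measure \x mu)%E (A `*` B)); last first.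
  exact: product_measure1E.
rewrite /cons_measure /pushforward; congr ((lebesgue_measure \x mu)%E _).
apply/seteqP; split=> -[a v] /=; rewrite cons_colvec0.
  move=> [Aa]; rewrite (_ : \col_i _ = v)//.
  by apply/colP => i; rewrite mxE cons_colvecS.
move=> [Aa Bv]; split=> //; rewrite (_ : \col_i _ = v)//.
by apply/colP => i; rewrite mxE cons_colvecS.
Qed.

Let cons_measure_sigma_finite : sigma_finite setT cons_measure.
Proof.
have /sigma_finiteP[F [TF ndF Foo]] := sigma_finiteT (@lebesgue_measure R).
have /sigma_finiteP[G [TG ndG Goo]] := sigma_finiteT mu.
pose tail (u : 'cV[R]_n.+1) : 'cV[R]_n := \col_i u (lift ord0 i) ord0.
have mtail : measurable_fun setT tail.
  apply: measurable_fun_colvec => i /=.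
  by under eq_fun do rewrite mxE; exact: measurable_coord.
exists (fun k => [set u : 'cV[R]_n.+1 | F k (u ord0 ord0) /\ G k (tail u)]).
  apply/seteqP; split=> // u _.
  have [k _ Fk] : (\bigcup_k F k) (u ord0 ord0) by rewrite -TF.
  have [l _ Gl] : (\bigcup_k G k) (tail u) by rewrite -TG.
  exists (maxn k l) => //; split.
  - by move: Fk; apply/subsetPset/ndF/leq_maxl.
  - by move: Gl; apply/subsetPset/ndG/leq_maxr.
move=> k; have [mF Fk] := Foo k; have [mG Gk] := Goo k; split.
  rewrite (_ : [set _ | _] =
    (fun u : 'cV[R]_n.+1 => u ord0 ord0) @^-1` F k `&` tail @^-1` G k)//.
  apply: measurableI; rewrite -[X in measurable X]setTI; last exact: mtail.
  exact: measurable_coord.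
by rewrite cons_measureX// lte_mul_pinfty// ge0_fin_numE.
Qed.

HB.instance Definition _ := Measure_isSigmaFinite.Build _ _ _ cons_measure
  cons_measure_sigma_finite.

End cons_measure.

Fixpoint lebesgue_colvec n : {sigma_finite_measure set 'cV[R]_n -> \bar R} :=
  match n with
  | 0 => \d_(0 : 'cV[R]_0)
  | m.+1 => cons_measure (lebesgue_colvec m)
  end.

End lebesgue_colvec.

Definition gamma_fun {R : realType} (a : R) : R :=
  \int[lebesgue_measure]_(t in `]0, +oo[) (t `^ (a - 1) * expR (- t)).

Section gamma_kernels.
Context {R : realType}.
Implicit Types x h u : R.

Definition gamma_kernel x h u : R :=
  u `^ (x / h) * expR (- u / h) /
    (gamma_fun (1 + x / h) * h `^ (1 + x / h)) *
  \1_(`[0, +oo[ : set R) u.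

Definition rho x h : R := if x < 2 * h then 1 + (x / (2 * h)) ^+ 2 else x / h.

Definition modified_gamma_kernel x h u : R :=
  u `^ (rho x h - 1) * expR (- u / h) /
    (gamma_fun (rho x h) * h `^ (rho x h)) *
  \1_(`[0, +oo[ : set R) u.

Definition a_tilde x h : R :=
  (x ^+ 2 + 4 * h * (h - x)) / (4 * h) * \1_(`[0, 2 * h[ : set R) x.

Definition b_tilde x h : R :=
  if x <= 2 * h then (x ^+ 2 + 4 * h ^+ 2) / 4 else x * h.

(* Indices are shifted to start at 0: the first [d - l] coordinates carry the
   standard kernel and the last [l] ones the modified kernel. *)
Definition combined_gamma_kernel d (l : nat) (x h u : 'cV[R]_d) : R :=
  (\prod_(s < d | (s < d - l)%N) gamma_kernel (x s 0) (h s 0) (u s 0)) *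
  (\prod_(r < d | (d - l <= r)%N)
     modified_gamma_kernel (x r 0) (h r 0) (u r 0)).

End gamma_kernels.

Section associated_kernel.
Context {R : realType} {d : nat}.

Definition nonneg_orthant : set 'cV[R]_d := [set u | forall j, 0 <= u j 0].

Definition pos_orthant : set 'cV[R]_d := [set u | forall j, 0 < u j 0].

(* [S] need not be closed: between [f] vanishing off [S] and [S] being contained
   in the closed support, [S] is the support of [f] up to boundary points. For a
   closed [S] it is exactly the closed support. *)
Definition is_pdf_on (S : set 'cV[R]_d) (f : 'cV[R]_d -> R) : Prop :=
  [/\ measurable S, measurable_fun setT f, (forall u, 0 <= f u),
      (forall u, ~ S u -> f u = 0) /\ S `<=` closure [set u | f u != 0] &
      (\int[lebesgue_colvec d]_u (f u)%:E = 1)%E].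

Section random_vector.
Context {disp : measure_display} {T : measurableType disp}
  (P : probability T R) (X : {RV P >-> 'cV[R]_d}).

Definition has_pdf (f : 'cV[R]_d -> R) : Prop :=
  forall A : set 'cV[R]_d, measurable A ->
    distribution P X A = (\int[lebesgue_colvec d]_(u in A) (f u)%:E)%E.

Definition coordinate (j : 'I_d) (w : T) : R := X w j 0.

Definition has_mean (m : 'cV[R]_d) : Prop :=
  forall j, P.-integrable setT (EFin \o coordinate j) /\
    ('E_P[coordinate j] = (m j 0)%:E)%E.

Definition has_covariance_matrix (V : 'M[R]_d) : Prop :=
  forall i j, coordinate j \in Lfun P 2%:E /\
    covariance P (coordinate i) (coordinate j) = (V i j)%:E.

End random_vector.

(* Associated kernel for a target density supported by the nonnegative orthant,
   with mean [x + A x h] and covariance matrix [B x h]. *)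
Definition associated_kernel_with
    (S : 'cV[R]_d -> 'cV[R]_d -> set 'cV[R]_d)
    (K : 'cV[R]_d -> 'cV[R]_d -> 'cV[R]_d -> R)
    (A : 'cV[R]_d -> 'cV[R]_d -> 'cV[R]_d)
    (B : 'cV[R]_d -> 'cV[R]_d -> 'M[R]_d) : Prop :=
  (forall x h, nonneg_orthant x -> pos_orthant h ->
    [/\ is_pdf_on (S x h) (K x h), S x h x &
        forall (disp : measure_display) (T : measurableType disp)
          (P : probability T R) (X : {RV P >-> 'cV[R]_d}),
          has_pdf X (K x h) ->
          has_mean X (x + A x h) /\ has_covariance_matrix X (B x h)]) /\
  (forall x, nonneg_orthant x ->
    A x h @[h --> within pos_orthant (nbhs (0 : 'cV[R]_d))] --> (0 : 'cV[R]_d) /\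
    B x h @[h --> within pos_orthant (nbhs (0 : 'cV[R]_d))] --> (0 : 'M[R]_d)).

End associated_kernel.

(* Main.v *)
Require Import Defs.
From HB Require Import structures.
From mathcomp Require Import all_boot all_order all_algebra.
From mathcomp Require Import all_classical all_reals all_analysis.
From mathcomp Require Import measurable_realfun ring lra.

Set Implicit Arguments.
Unset Strict Implicit.
Unset Printing Implicit Defensive.

Import Order.TTheory GRing.Theory Num.Theory.
Import numFieldNormedType.Exports.

Local Open Scope classical_set_scope.
Local Open Scope ring_scope.

(* The standard and the modified kernel are both gamma densities of scale [h],
   of shapes [1 + x / h] and [rho x h], both at least 1. The gamma recurrence
   therefore gives mean [h * a] and variance [h ^+ 2 * a] for shape [a], and the
   stated formulas are these two quantities rewritten. By Tonelli, integrals of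
   products of functions of one coordinate against the product density factor,
   so that coordinates have the one-dimensional moments and are uncorrelated.
   The only limits that are not immediate are those of the modified kernel: if
   [0 < x] then [2 * h < x] eventually, with bias 0 and variance [x * h], while
   if [x = 0] they are [h] and [h ^+ 2]. *)

(** * Continuity, decay and integrability of the gamma integrand *)

Section gamma_integrals.
Context {R : realType}.
Implicit Types (a p h t u : R).
Notation mu := (@lebesgue_measure R).

(* [t / (2 * p) <= expR (t / (2 * p))], raised to the power [p]. *)
Lemma powR_le_expR p t : 0 <= p -> 0 <= t ->
  t `^ p <= (2 * p) `^ p * expR (t / 2).
Proof.
rewrite le_eqVlt => /predU1P[<- t0|p0 t0].
  rewrite !powRr0 mul1r; apply: le_trans (expR_ge1Dx _); lra.
have q0 : 0 < 2 * p by rewrite mulr_gt0.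
have tE : t = 2 * p * (t / (2 * p)) by rewrite mulrC divfK// gt_eqF.
have s0 : 0 <= t / (2 * p) by rewrite divr_ge0// ltW.
rewrite {1}tE powRM// ?(ltW q0)// ler_wpM2l ?powR_ge0//.
have -> : t / 2 = t / (2 * p) * p by field; rewrite gt_eqF.
rewrite expRM ge0_ler_powR ?nnegrE ?expR_ge0// ?(ltW p0)//.
by apply: le_trans (expR_ge1Dx _); lra.
Qed.

Definition gamma_integrand p h u := u `^ p * expR (- u / h).

Lemma gamma_integrand_ge0 p h u : 0 <= gamma_integrand p h u.
Proof. by rewrite mulr_ge0 ?powR_ge0 ?expR_ge0. Qed.

Lemma continuous_gamma_integrand p h : 0 <= p ->
  {within `[0, +oo[, continuous (gamma_integrand p h)}.
Proof.
move=> p0.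
have cE u : {for u, continuous (fun u => expR (- u / h))}.
  apply: continuous_comp; last exact: continuous_expR.
  by apply: cvgMl; exact: cvgN.
apply/continuous_within_itvcyP; split.
  move=> u; rewrite in_itv/= andbT => u0.
  apply: cvgM; last exact: cE.
  have /derivable1_diffP/differentiable_continuous :
      derivable (@powR R ^~ p) u 1.
    by apply: derivable_powR; rewrite in_itv/= andbT.
  exact.
apply: cvgM; last by apply: cvg_at_right_filter; exact: cE.
move: p0; rewrite le_eqVlt => /predU1P[<-|p0].
  by rewrite powRr0; under eq_fun do rewrite powRr0; exact: cvg_cst.
by rewrite powR0 ?gt_eqF//; exact: powR_cvg0.
Qed.

Lemma measurable_gamma_integrand p h :
  measurable_fun setT (gamma_integrand p h).
Proof.
apply: measurable_funM; first exact: measurable_powR.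
by apply: measurableT_comp => //; apply: measurable_funM.
Qed.

(** Half of the exponential decay absorbs the power and the other half remains. This single bound
    serves both the limit at infinity and integrability. *)
Lemma gamma_integrand_le p t : 0 <= p -> 0 <= t ->
  gamma_integrand p 1 t <= (2 * p) `^ p * expR (- (t / 2)).
Proof.
move=> p0 t0;
  apply: (le_trans (y := (2 * p) `^ p * expR (t / 2) * expR (- t / 1))).
  by rewrite ler_wpM2r ?expR_ge0// powR_le_expR.
rewrite -mulrA -expRD.
by have -> : t / 2 + - t / 1 = - (t / 2) by field.
Qed.

Lemma gamma_integrand_cvgy p : 0 <= p ->
  gamma_integrand p 1 t @[t --> +oo] --> (0 : R).
Proof.
move=> p0.
apply: (@squeeze_cvgr _ _ _ _ (fun=> 0)
  (fun t => (2 * p) `^ p * expR (- (t / 2)))).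
- near=> t; have t0 : 0 <= t by near: t; exact: nbhs_pinfty_ge.
  by rewrite gamma_integrand_ge0 gamma_integrand_le.
- exact: cvg_cst.
- rewrite -(mulr0 ((2 * p) `^ p)); apply: cvgMr.
  apply: (@cvg_comp _ _ _ (fun t => t / 2) (fun z => expR (- z)) _
    (pinfty_nbhs R)); last exact: cvgr_expR.
  by apply: gt0_cvgMly.
Unshelve. all: by end_near. Qed.

Lemma integrable_gamma_integrand p : 0 <= p ->
  mu.-integrable `[0, +oo[ (EFin \o gamma_integrand p 1).
Proof.
move=> p0.
have r0 : (0:R) < 2^-1 by lra.
have m0y : measurable (`[(0:R), +oo[%classic : set (measurableTypeR R)).
  exact: measurable_itv.
have iexp := integrableS measurableT m0y (@subsetT _ _)
  (integrable_exponential_pdf r0).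
(* The dominating function is a multiple of the exponential density of rate 1/2; the factor 2
   cancels the rate in front of that density. *)
apply: (le_integrable m0y _ _ (integrableZl m0y (2 * (2 * p) `^ p) iexp)).
  apply/measurable_EFinP; apply: measurable_funTS.
  exact: measurable_gamma_integrand.
move=> t; rewrite /= in_itv/= andbT => t0; rewrite lee_fin.
rewrite exponential_pdfE// !ger0_norm ?gamma_integrand_ge0//; last first.
  by rewrite !mulr_ge0 ?powR_ge0 ?expR_ge0.
apply: le_trans (gamma_integrand_le p0 t0) _.
rewrite le_eqVlt; apply/orP; left; apply/eqP.
have -> : - 2^-1 * t = - (t / 2) by field.
by field.
Qed.

End gamma_integrals.

(** * The gamma function: positivity, recurrence, change of scale *)

Section gamma_function.
Context {R : realType}.
Implicit Types (a p h t u : R).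
Notation mu := (@lebesgue_measure R).

(** [gamma_fun] is a real-valued integral over the open half-line. The endpoint 0 is negligible, and
    nothing is lost in passing to a real number because the integral is finite. *)
Lemma integral_gamma_integrand1 a : 1 <= a ->
  (\int[mu]_(t in `[0%R, +oo[) (gamma_integrand (a - 1) 1 t)%:E =
    (gamma_fun a)%:E)%E.
Proof.
move=> a1; have p0 : 0 <= a - 1 by lra.
rewrite /gamma_fun /Rintegral integral_itv_obnd_cbnd; last first.
  apply/measurable_EFinP/measurable_funTS.
  apply: measurable_funM; first exact: measurable_powR.
  by apply: measurableT_comp => //; exact: measurable_oppr.
have -> : (\int[mu]_(t in `[0%R, +oo[) (t `^ (a - 1) * expR (- t))%:E =
    \int[mu]_(t in `[0%R, +oo[) (gamma_integrand (a - 1) 1 t)%:E)%E.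
  by apply: eq_integral => t _; rewrite /gamma_integrand divr1.
rewrite fineK//.
exact: (integrable_fin_num _ (integrable_gamma_integrand p0)).
Qed.

(** On [[1, 2]] the power is at least 1, its exponent being nonnegative, and the exponential is at
    least [expR (- 2)]; this interval alone gives a positive lower bound. *)
Lemma gamma_fun_gt0 a : 1 <= a -> 0 < gamma_fun a.
Proof.
move=> a1; have p0 : 0 <= a - 1 by lra.
have h2 : (0 : R) < expR (- 2) by exact: expR_gt0.
rewrite -lte_fin -integral_gamma_integrand1//.
apply: (@lt_le_trans _ _ (\int[mu]_(t in `[1%R, 2%R]) (expR (- 2))%:E)%E).
  rewrite (integral_cst mu)//= lebesgue_measure_itv/= lte_fin ltr1n.
  by rewrite -EFinD -EFinM lte_fin mulr_gt0//; lra.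
have m0y : measurable_fun (`[(0:R), +oo[%classic : set (measurableTypeR R))
    (EFin \o @gamma_integrand R (a - 1) 1).
  apply/measurable_EFinP; apply: measurable_funTS.
  exact: measurable_gamma_integrand.
have s0y : `[(1:R), 2] `<=` `[(0:R), +oo[.
  by move=> t /=; rewrite !in_itv/= andbT => /andP[? _]; lra.
apply: (@le_trans _ _
    (\int[mu]_(t in `[1%R, 2%R]) (gamma_integrand (a - 1) 1 t)%:E)%E); last first.
  apply: ge0_subset_integral => //= t _; rewrite lee_fin.
  exact: gamma_integrand_ge0.
apply: ge0_le_integral => //=.
- exact: measurable_funS m0y.
- move=> t; rewrite /= in_itv/= => /andP[t1 t2]; rewrite lee_fin.
  have e1 : (1 : R) `^ (a - 1) = 1 by rewrite powR1.
  rewrite -[leLHS]mul1r -[X in X * _]e1 ler_pM ?powR_ge0 ?ler_expR//.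
    by rewrite ge0_ler_powR ?nnegrE// (le_trans ler01 t1).
  by rewrite divr1 lerN2.
Qed.

Lemma is_derive_gamma_integrand a t : 0 < t ->
  is_derive t 1 (gamma_integrand a 1)
    (a * gamma_integrand (a - 1) 1 t - gamma_integrand a 1 t).
Proof.
move=> t0.
have d1 := is_derive1_powR a t0.
have d2 : is_derive t 1 (fun u => expR (- u / 1)) (- expR (- t / 1)).
  have -> : (fun u => expR (- u / 1)) = expR \o -%R.
    by apply/funext => u /=; rewrite divr1.
  apply: is_derive_eq; rewrite divr1; lra.
apply: is_derive_eq; rewrite /gamma_integrand.
by rewrite /GRing.scale/=; ring.
Qed.

(** Integration by parts in the form of a vanishing integral: [f] is the derivative of [F], which is
    0 at 0 and tends to 0 at infinity, and the two terms of [f] integrate to the two sides of the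
    recurrence. *)
Lemma gamma_funD1 a : 1 <= a -> gamma_fun (a + 1) = a * gamma_fun a.
Proof.
move=> a1; have a0 : 0 < a by lra.
have p0 : 0 <= a - 1 by lra.
pose F t := - gamma_integrand a 1 t.
pose f t := gamma_integrand a 1 t - a * gamma_integrand (a - 1) 1 t.
have Ff t : 0 < t -> is_derive t 1 F (f t).
  move=> t0; have := is_derive_gamma_integrand a t0 => ?.
  by apply: is_derive_eq; rewrite /f opprB.
have cf : {within `[0, +oo[, continuous f}.
  apply/subspace_continuousP => t t0; apply: cvgB; last apply: cvgMr.
    by move: t t0; apply/subspace_continuousP/continuous_gamma_integrand/ltW.
  by move: t t0; apply/subspace_continuousP/continuous_gamma_integrand.
have [cF F0] : {in `]0, +oo[, continuous F} /\ F x @[x --> 0^'+] --> F 0.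
  apply/(@continuous_within_itvcyP R R R).
  apply/subspace_continuousP => t t0; apply: cvgN.
  by move: t t0; apply/subspace_continuousP/continuous_gamma_integrand/ltW.
have F00 : F 0 = 0 by rewrite /F /gamma_integrand powR0 ?mul0r ?oppr0// gt_eqF.
have dF t : 0 < t -> derivable F t 1 by move=> /Ff[].
have dFE t : 0 < t -> F^`()%classic t = f t.
  by move=> /Ff ?; rewrite derive1E derive_val.
have cFa : {for a, continuous F} by apply: cF; rewrite in_itv/= a0.
(* [f] changes sign at [a], and the improper fundamental theorem of calculus
   needs a nonnegative integrand. *)
have I1 : (\int[mu]_(t in `[0%R, a]) (f t)%:E = (F a)%:E)%E.
  rewrite (@continuous_FTC2 _ f F)// ?F00 ?sube0//.
  - apply: continuous_subspaceW cf => t /=.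
    by rewrite !in_itv/= andbT => /andP[].
  - split => //.
    + by move=> t; rewrite in_itv/= => /andP[t0 _]; exact: dF.
    + exact: cvg_at_left_filter.
  - by move=> t; rewrite in_itv/= => /andP[t0 _]; exact: dFE.
have I2 : (\int[mu]_(t in `[a, +oo[) (f t)%:E = - (F a)%:E)%E.
  rewrite (@ge0_continuous_FTC2y _ f F _ 0)// ?sub0e//.
  - move=> t at0; have t0 : 0 < t by exact: lt_le_trans a0 at0.
    (* Factoring one [t] out of the power exhibits [f t] as [t - a] times a nonnegative quantity. *)
    rewrite /f /gamma_integrand -(mulr_powRB1 (ltW t0) a0) -mulrA -mulrBl.
    by rewrite mulr_ge0 ?subr_ge0// mulr_ge0 ?powR_ge0 ?expR_ge0.
  - apply: continuous_subspaceW cf => t /=.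
    by rewrite !in_itv/= !andbT; apply: le_trans; exact: ltW.
  - by rewrite -oppr0; apply: cvgN; apply: gamma_integrand_cvgy; exact: ltW.
  - by move=> t at0; apply: dF; exact: lt_trans at0.
  - exact: cvg_at_right_filter.
  - by move=> t; rewrite in_itv/= andbT => at0; apply: dFE; exact: lt_trans at0.
have mf : measurable_fun setT f.
  apply: measurable_funB; first exact: measurable_gamma_integrand.
  by apply: measurable_funM => //; exact: measurable_gamma_integrand.
have I0 : (\int[mu]_(t in `[0%R, +oo[) (f t)%:E = 0)%E.
  rewrite (@itv_bndbnd_setU _ _ _ (BRight a)) ?bnd_simp ?ltW//.
  rewrite integral_setU//=.
  - rewrite I1 integral_itv_obnd_cbnd; first by rewrite I2 subee.
    exact/measurable_EFinP/measurable_funTS.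
  - exact/measurable_EFinP/measurable_funTS.
  - apply/disj_setPS => t /=; rewrite !in_itv/= andbT => -[/andP[_ ta] a_t].
    by move: (le_lt_trans ta a_t); rewrite ltxx.
have i1 := integrable_gamma_integrand (ltW a0).
have m0y : measurable (`[(0:R), +oo[%classic : set (measurableTypeR R)) by [].
have i2 := integrable_gamma_integrand p0.
have i3 := integrableZl m0y a i2.
move: I0; rewrite (integralB m0y i1 i3) integralZl//= integral_gamma_integrand1//.
have := @integral_gamma_integrand1 (a + 1); rewrite addrK => ->; last lra.
by rewrite -EFinM -EFinB => -[/eqP]; rewrite subr_eq0 => /eqP.
Qed.

Lemma integral_gamma_integrand p h : 0 <= p -> 0 < h ->
  (\int[mu]_(u in `[0%R, +oo[) (gamma_integrand p h u)%:E =
    (gamma_fun (p + 1) * h `^ (p + 1))%:E)%E.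
Proof.
move=> p0 h0; pose F := fun t : R => h * t.
have dF : F^`()%classic = fun=> h.
  by apply/funext => t; rewrite derive1E /F derive_val /GRing.scale/= mulr1.
have cF : continuous F by move=> t; apply: cvgMr; exact: cvg_id.
have F0 : F 0 = 0 by rewrite /F mulr0.
have := @increasing_ge0_integration_by_substitutiony R F (gamma_integrand p h) 0.
rewrite F0 dF => ->.
- transitivity (\int[mu]_(t in `[0%R, +oo[)
      ((h `^ (p + 1))%:E * (gamma_integrand p 1 t)%:E))%E.
    apply: eq_integral => t; rewrite inE/= in_itv/= andbT => t0.
    rewrite -EFinM; congr EFin.
    rewrite -[LHS]/(gamma_integrand p h (h * t) * h) /gamma_integrand.
    rewrite powRM// ?(ltW h0)//.
    have -> : - (h * t) / h = - t / 1 by field; rewrite gt_eqF.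
    have -> : h `^ (p + 1) = h * h `^ p.
      by rewrite -(@mulr_powRB1 _ _ (p + 1)) ?addrK ?(ltW h0)//; lra.
    by ring.
  rewrite integralZl//; last exact: integrable_gamma_integrand.
  have := @integral_gamma_integrand1 (p + 1); rewrite addrK => ->; last lra.
  by rewrite -EFinM mulrC.
- by move=> s t _ _ st; rewrite ltr_pM2l.
- by move=> t _; exact: cvg_cst.
- exact: is_cvg_cst.
- exact: is_cvg_cst.
- split; first by move=> t _; exact: derivableM.
  by apply: cvg_at_right_filter; exact: cF.
- exact: gt0_cvgMry.
- exact: continuous_gamma_integrand.
- by move=> t _; exact: gamma_integrand_ge0.
Qed.
End gamma_function.

(** * Gamma densities of shape [a] and scale [h], and their moments *)

Section gamma_pdf.
Context {R : realType}.
Implicit Types (a p h t u x : R) (k : nat).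
Notation mu := (@lebesgue_measure R).

Lemma gamma_funDn a k : 1 <= a ->
  gamma_fun (a + k%:R) = gamma_fun a * \prod_(i < k) (a + i%:R).
Proof.
move=> a1; elim: k => [|k IH]; first by rewrite addr0 big_ord0 mulr1.
rewrite -natr1 addrA gamma_funD1; last first.
  by rewrite (le_trans a1)// lerDl.
by rewrite IH big_ord_recr/=; ring.
Qed.

Lemma exprn_powR p u k : 0 <= p -> 0 <= u -> u ^+ k * u `^ p = u `^ (p + k%:R).
Proof.
move=> p0 u0; elim: k => [|k IH]; first by rewrite addr0 mul1r.
(* The exponent [p + k.+1] is positive, so the factorisation is valid at [u = 0] too. *)
rewrite exprS -mulrA IH -(@mulr_powRB1 _ _ (p + k.+1%:R)) ?ltr_wpDl//.
by rewrite -natr1 addrA addrK.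
Qed.

Definition gamma_pdf a h u : R :=
  gamma_integrand (a - 1) h u / (gamma_fun a * h `^ a) *
  \1_(`[0, +oo[ : set R) u.

Lemma gamma_pdf_ge0 a h u : 1 <= a -> 0 < h -> 0 <= gamma_pdf a h u.
Proof.
move=> a1 h0; rewrite mulr_ge0// divr_ge0 ?gamma_integrand_ge0//.
by rewrite mulr_ge0 ?powR_ge0// ltW// gamma_fun_gt0.
Qed.

Lemma gamma_pdf_gt0 a h u : 1 <= a -> 0 < h -> 0 < u -> 0 < gamma_pdf a h u.
Proof.
move=> a1 h0 u0; rewrite /gamma_pdf indicE mem_set /=; last first.
  by rewrite in_itv/= ltW.
by rewrite mulr1 divr_gt0 ?mulr_gt0 ?powR_gt0 ?expR_gt0 ?gamma_fun_gt0.
Qed.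

Lemma gamma_pdf_lt0 a h u : u < 0 -> gamma_pdf a h u = 0.
Proof.
move=> u0; rewrite /gamma_pdf indicE memNset ?mulr0//= in_itv/= andbT.
by apply/negP; rewrite -ltNge.
Qed.

Lemma measurable_gamma_pdf a h : measurable_fun setT (gamma_pdf a h).
Proof.
apply: measurable_funM; last exact: measurable_indic.
by apply: measurable_funM => //; exact: measurable_gamma_integrand.
Qed.

(** Multiplying by the [k]-th power raises the shape by [k], and the ratio of the gamma values at
    [a + k] and [a] is a rising factorial. The absolute value makes the integrand nonnegative on the
    whole line and changes nothing where the density lives. Order 0 is the normalisation. *)
Lemma integral_gamma_pdf a h k : 1 <= a -> 0 < h ->
  (\int[mu]_u (`|u| ^+ k * gamma_pdf a h u)%:E =
    (h ^+ k * \prod_(i < k) (a + i%:R))%:E)%E.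
Proof.
move=> a1 h0; have p0 : 0 <= a - 1 by lra.
have q0 : 0 <= a - 1 + k%:R by rewrite addr_ge0.
set c := (gamma_fun a * h `^ a)^-1.
have c0 : 0 <= c.
  by rewrite invr_ge0 mulr_ge0 ?powR_ge0// ltW// gamma_fun_gt0.
transitivity (\int[mu]_(u in `[0%R, +oo[)
    (c%:E * (gamma_integrand (a - 1 + k%:R) h u)%:E))%E.
  rewrite [RHS]integral_mkcond; apply: eq_integral => u _.
  rewrite patchE; case: ifPn => [|u0].
    rewrite inE/= in_itv/= andbT => u0; rewrite /gamma_pdf indicE mem_set/=.
      rewrite mulr1 -EFinM -/c ger0_norm// /gamma_integrand -exprn_powR//.
      by congr EFin; ring.
    by rewrite in_itv/= u0.
  rewrite gamma_pdf_lt0 ?mulr0//; move: u0; rewrite notin_setE/= in_itv/= andbT.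
  by move/negP; rewrite -ltNge.
rewrite ge0_integralZl//; last 2 first.
- apply/measurable_EFinP; apply: measurable_funTS.
  exact: measurable_gamma_integrand.
- by move=> u _; rewrite lee_fin gamma_integrand_ge0.
rewrite integral_gamma_integrand//.
have -> : a - 1 + k%:R + 1 = a + k%:R by ring.
rewrite gamma_funDn// -(exprn_powR k _ (ltW h0)) ?(le_trans ler01 a1)//.
rewrite -EFinM; congr EFin; rewrite /c; field.
by rewrite !gt_eqF ?powR_gt0 ?gamma_fun_gt0.
Qed.

Lemma gamma_kernelE x h u : gamma_kernel x h u = gamma_pdf (1 + x / h) h u.
Proof. by rewrite /gamma_pdf [1 + _ - 1]addrAC subrr add0r. Qed.

Lemma modified_gamma_kernelE x h u :
  modified_gamma_kernel x h u = gamma_pdf (rho x h) h u.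
Proof. by []. Qed.

Lemma rho_ge1 x h : 0 < h -> 1 <= rho x h.
Proof.
move=> h0; rewrite /rho; case: ltP => xh; first by rewrite lerDl sqr_ge0.
by rewrite ler_pdivlMr//; lra.
Qed.

End gamma_pdf.

(** * Tonelli for products of functions of one coordinate *)

Section lebesgue_colvec_product.
Context {R : realType}.
Notation mu := (@lebesgue_measure R).

Lemma measurable_fun_prod_coord n (g : 'I_n -> R -> R) :
  (forall i, measurable_fun setT (g i)) ->
  measurable_fun setT (fun u : 'cV[R]_n => \prod_i g i (u i 0)).
Proof.
move=> mg; apply: measurable_prod => i _.
exact: (measurableT_comp (mg i) (measurable_coord i)).
Qed.

(** Induction along the construction of [lebesgue_colvec]: in dimension 0 a Dirac mass integrates
    the empty product to 1, and in dimension [n.+1] the integral is pulled back to a binary product,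
    where Tonelli splits off the first coordinate. *)
Lemma integral_lebesgue_colvec_prod n (g : 'I_n -> R -> R) (c : 'I_n -> R) :
  (forall i, measurable_fun setT (g i)) -> (forall i t, 0 <= g i t) ->
  (forall i, (\int[mu]_t (g i t)%:E = (c i)%:E)%E) ->
  (\int[lebesgue_colvec n]_u (\prod_i g i (u i 0))%:E = (\prod_i c i)%:E)%E.
Proof.
elim: n g c => [|n IH] g c mg g0 gc.
  rewrite /= big_ord0.
  rewrite integral_dirac//; first by rewrite diracT mul1e big_ord0.
  by apply/measurable_EFinP; apply: measurable_fun_prod_coord.
have mG := measurable_fun_prod_coord mg.
rewrite /= /cons_measure ge0_integral_pushforward//=; last first.
- by move=> y _; rewrite lee_fin prodr_ge0.
- exact/measurable_EFinP.
- exact: measurable_cons_colvec.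
rewrite preimage_setT.
pose tl (v : 'cV[R]_n) := \prod_i g (lift ord0 i) (v i 0).
have tl0 v : 0 <= tl v by apply: prodr_ge0.
have mtl : measurable_fun setT tl.
  by apply: (measurable_fun_prod_coord (g := fun i => g (lift ord0 i))) => i.
transitivity (\int[(lebesgue_measure \x lebesgue_colvec n)%E]_p
    (g ord0 p.1 * tl p.2)%:E)%E.
  apply: eq_integral => p _; rewrite /= big_ord_recl cons_colvec0.
  by under eq_bigr do rewrite cons_colvecS.
rewrite fubini_tonelli1; last 2 first.
- apply/measurable_EFinP; apply: measurable_funM.
    exact: (measurableT_comp (mg ord0) measurable_fst).
  exact: (measurableT_comp mtl measurable_snd).
- by move=> p; rewrite lee_fin mulr_ge0.
rewrite /fubini_F.
transitivity (\int[lebesgue_measure]_t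
    ((g ord0 t)%:E * (\prod_i c (lift ord0 i))%:E))%E.
  apply: eq_integral => t _ /=; under eq_integral do rewrite EFinM.
  rewrite ge0_integralZl//.
  - congr (_ * _)%E; exact: (IH (fun i => g (lift ord0 i))).
  - exact/measurable_EFinP.
  - by move=> v _; rewrite lee_fin.
  - by rewrite lee_fin.
rewrite ge0_integralZr//.
- by rewrite gc big_ord_recl EFinM.
- apply/measurable_EFinP; exact: (mg ord0).
- by move=> t _; rewrite lee_fin.
- rewrite lee_fin prodr_ge0// => i _; rewrite -lee_fin -gc integral_ge0// => t _.
  by rewrite lee_fin.
Qed.
End lebesgue_colvec_product.

(** This takes [has_pdf], which speaks of measures of sets, to integrals of functions. The density
    forces [nu] to be dominated by [mu], and finiteness of [nu] makes [f] integrable, so [f] can be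
    compared with the Radon-Nikodym derivative. *)
Lemma ge0_integral_density (disp : measure_display) (T : measurableType disp)
    (R : realType) (nu : {finite_measure set T -> \bar R})
    (mu : {sigma_finite_measure set T -> \bar R}) (f g : T -> R) :
  measurable_fun setT f -> (forall x, 0 <= f x) ->
  (forall A, measurable A -> nu A = (\int[mu]_(x in A) (f x)%:E)%E) ->
  measurable_fun setT g -> (forall x, 0 <= g x) ->
  (\int[nu]_x (g x)%:E = \int[mu]_x (g x * f x)%:E)%E.
Proof.
move=> mf f0 nuf mg g0.
have mfE : measurable_fun setT (EFin \o f) by exact/measurable_EFinP.
have dom : nu `<< mu.
  apply/null_content_dominatesP => A mA muA0; rewrite nuf//.
  apply: null_set_integral => //; exact: measurable_funS mfE.
rewrite -(Radon_Nikodym_SigmaFinite.change_of_variables dom)//; last first.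
  exact/measurable_EFinP.
(* [f] is a version of the Radon-Nikodym derivative, for which the change of
   variables is available. *)
have fRN : ae_eq mu setT (EFin \o f) (Radon_Nikodym_SigmaFinite.f nu mu).
  apply: integral_ae_eq => //.
  - apply/integrableP; split => //=.
    under eq_integral do rewrite ger0_norm//.
    rewrite -nuf//; exact: fin_num_fun_lty.
  - exact: measurable_int (Radon_Nikodym_SigmaFinite.f_integrable dom).
  - move=> A _ mA.
    by rewrite /= -nuf// (Radon_Nikodym_SigmaFinite.f_integral dom).
apply: ae_eq_integral => //.
- apply: emeasurable_funM; first exact/measurable_EFinP.
  exact: measurable_int (Radon_Nikodym_SigmaFinite.f_integrable dom).
- by apply/measurable_EFinP; apply: measurable_funM.
- by apply: filterS fRN => x /(_ I) /= fx _; rewrite EFinM fx.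
Qed.

(** With 0-1 exponents a monomial in all coordinates reduces to one coordinate, so that first and
    second moments are instances of one formula for mixed moments. *)
Lemma prod_expr_pred1 (R : comNzRingType) (I : finType) (x : I -> R) (j : I) :
  \prod_i x i ^+ (i == j) = x j.
Proof.
rewrite (bigD1 j)//= eqxx expr1 big1 ?mulr1// => i /negPf ->.
by rewrite expr0.
Qed.

(** * Mean and covariance of a random vector with a product density *)

Section product_density.
Context {R : realType} (d : nat) (disp : measure_display)
  (T : measurableType disp) (P : probability T R) (X : {RV P >-> 'cV[R]_d}).
Variables (k : 'I_d -> R -> R) (m : 'I_d -> nat -> R).
Hypotheses (mk : forall i, measurable_fun setT (k i))
  (k0 : forall i t, 0 <= k i t)
  (k_lt0 : forall i t, t < 0 -> k i t = 0)
  (mE : forall i n,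
    (\int[lebesgue_measure]_t (`|t| ^+ n * k i t)%:E = (m i n)%:E)%E)
  (m0 : forall i, m i 0 = 1)
  (Xk : has_pdf X (fun u => \prod_i k i (u i 0))).

Lemma measurable_coordinate j : measurable_fun setT (coordinate X j).
Proof. exact: (measurableT_comp (measurable_coord j)). Qed.

(** Absolute values keep all integrands nonnegative, so the law of [X] can be replaced by its
    density and Tonelli applied with no integrability to check. Each power joins the factor of its
    own coordinate. *)
Lemma expectation_prod_norm (e : 'I_d -> nat) :
  (\int[P]_w (\prod_i `|coordinate X i w| ^+ e i)%:E =
    (\prod_i m i (e i))%:E)%E.
Proof.
have mg i : measurable_fun setT (fun t : R => `|t| ^+ e i).
  by apply: measurable_funX; exact: normr_measurable.
have mG : measurable_fun setT (fun u : 'cV[R]_d => \prod_i `|u i 0| ^+ e i).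
  exact: (measurable_fun_prod_coord mg).
rewrite -(integral_lebesgue_colvec_prod
  (g := fun i t => `|t| ^+ e i * k i t))//; last 2 first.
- by move=> i; apply: measurable_funM.
- by move=> i t; rewrite mulr_ge0.
under [RHS]eq_integral do rewrite big_split/=.
rewrite -(ge0_integral_density (nu := distribution P X))//.
- rewrite ge0_integral_distribution//; first exact/measurable_EFinP.
  by move=> u; rewrite lee_fin prodr_ge0// => i _; rewrite exprn_ge0.
- exact: measurable_fun_prod_coord.
- by move=> u; rewrite prodr_ge0.
- by move=> u; rewrite prodr_ge0// => i _; rewrite exprn_ge0.
Qed.

Lemma expectation_norm j :
  (\int[P]_w (`|coordinate X j w|)%:E = (m j 1)%:E)%E.
Proof.
have := expectation_prod_norm (fun i => nat_of_bool (i == j)).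
under eq_integral do rewrite prod_expr_pred1.
move=> ->; rewrite (bigD1 j)//= eqxx big1 ?mulr1// => i /negPf ->.
exact: m0.
Qed.

Lemma expectation_norm_mul i j :
  (\int[P]_w (`|coordinate X i w| * `|coordinate X j w|)%:E =
    (if i == j then m i 2 else m i 1 * m j 1)%:E)%E.
Proof.
(* Adding the two indicators treats both cases at once: the exponent is 2 at [i] when [i = j], and 1
   at each of [i] and [j] otherwise. *)
have := expectation_prod_norm (fun l => ((l == i) + (l == j))%N).
under eq_integral.
  move=> w _; under eq_bigr do rewrite exprD.
  rewrite big_split/= !prod_expr_pred1; over.
move=> ->; congr EFin; case: eqVneq => [->|ij].
  rewrite (bigD1 j)//= eqxx big1 ?mulr1// => l /negPf ->; exact: m0.
have ji : j != i by rewrite eq_sym.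
rewrite (bigD1 i)//= (bigD1 j)//= !eqxx (negPf ij) (negPf ji).
rewrite addn0 add0n big1 ?mulr1// => l /andP[/negPf -> /negPf ->]; exact: m0.
Qed.

(** The [j]-th factor kills the density on the half-space where coordinate [j] is negative. This
    allows the absolute values in the moments to be removed. *)
Lemma ae_coordinate_ge0 j : {ae P, forall w, 0 <= coordinate X j w}.
Proof.
pose A := [set u : 'cV[R]_d | u j 0 < 0].
have mA : measurable A.
  rewrite (_ : A = (fun u : 'cV[R]_d => u j 0) @^-1` `]-oo, 0[); last first.
    by apply/seteqP; split => u; rewrite /A/= in_itv.
  by rewrite -[X in measurable X]setTI; exact: measurable_coord.
exists (X @^-1` A); split.
- by rewrite -[X in measurable X]setTI; exact: (measurable_funP X).
- transitivity (distribution P X A) => //.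
  rewrite Xk//; apply: integral0_eq => u Au.
  by rewrite (bigD1 j)//= k_lt0// mul0r.
- by move=> w /negP; rewrite -ltNge.
Qed.

Lemma has_mean_product_density : has_mean X (\col_i m i 1%N).
Proof.
move=> j; split.
  apply/integrableP; split; first exact/measurable_EFinP/measurable_coordinate.
  by under eq_integral do rewrite /= ; rewrite expectation_norm ltry.
rewrite unlock mxE -expectation_norm; apply: ae_eq_integral => //.
- exact/measurable_EFinP/measurable_coordinate.
- apply/measurable_EFinP; apply: measurableT_comp => //.
  exact: measurable_coordinate.
- by apply: filterS (ae_coordinate_ge0 j) => w Xw _ /=; rewrite ger0_norm.
Qed.

Lemma coordinate_Lfun2 j : coordinate X j \in Lfun P 2%:E.
Proof.
rewrite inE; apply/andP; split; rewrite inE/=.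
  exact: measurable_coordinate.
rewrite /finite_norm unlock; apply: poweR_lty.
rewrite (_ : integral _ _ _ = (m j 2)%:E) ?ltry//.
have := expectation_norm_mul j j; rewrite eqxx => <-.
apply: eq_integral => w _ /=.
by rewrite powR_mulrn// expr2.
Qed.

Lemma has_covariance_matrix_product_density :
  has_covariance_matrix X (diag_mx (\row_i (m i 2 - m i 1%N ^+ 2))).
Proof.
move=> i j; split; first exact: coordinate_Lfun2.
have L1 l : coordinate X l \in Lfun P 1.
  apply: (Lfun_subset12 _ (coordinate_Lfun2 l)); exact: fin_num_measure.
have EX l : 'E_P[coordinate X l]%E = (m l 1%N)%:E.
  by have [_ ->] := has_mean_product_density l; rewrite mxE.
rewrite covarianceE//; last first.
  exact: Lfun2_mul_Lfun1 (coordinate_Lfun2 _) (coordinate_Lfun2 _).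
rewrite !EX.
(* For [i != j] the mixed moment factors into the two means, and the covariance cancels. *)
have -> : ('E_P[coordinate X i * coordinate X j] =
    (if i == j then m i 2 else m i 1%N * m j 1%N)%:E)%E.
  rewrite unlock -expectation_norm_mul; apply: ae_eq_integral => //.
  - apply/measurable_EFinP; apply: measurable_funM; exact: measurable_coordinate.
  - apply/measurable_EFinP; apply: measurable_funM;
      apply: measurableT_comp => //; exact: measurable_coordinate.
  - apply: filterS2 (ae_coordinate_ge0 i) (ae_coordinate_ge0 j) => w Xi Xj _ /=.
    by rewrite !ger0_norm.
rewrite -EFinM -EFinB !mxE; case: eqVneq => [->|ij].
  by rewrite mulr1n expr2.
by rewrite subrr mulr0n.
Qed.

End product_density.

(** * Limits as the bandwidths tend to 0, and topology of the orthants *)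

Section limits.
Context {R : realType}.

(** A matrix neighbourhood contains a product of neighbourhoods of the finitely many entries, and a
    filter is stable under finite intersections. *)
Lemma cvg_mx {T : Type} (F : set_system T) {FF : Filter F} m n
    (f : T -> 'M[R]_(m, n)) (M : 'M[R]_(m, n)) :
  (forall i j, f t i j @[t --> F] --> M i j) -> f @ F --> M.
Proof.
move=> fM A [Q MQ QA]; rewrite nbhs_filterE.
have : \forall t \near F, forall i, forall j, Q i j (f t i j).
  apply: filter_forall => i; apply: filter_forall => j.
  exact: (fM i j _ (MQ i j)).
by apply: filterS => t Qt; apply: QA.
Qed.

(** Restricting to positive bandwidths turns the limit at 0 of each coordinate into a limit from the
    right, which reduces vector limits to one-variable ones. *)
Lemma cvg_coord_pos_orthant d (j : 'I_d) :
  (fun h : 'cV[R]_d => h j 0) @ within pos_orthant (nbhs (0 : 'cV[R]_d))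
    --> (0 : R)^'+.
Proof.
move=> A A0.
have := @coord_continuous R d 1 j 0 (0 : 'cV[R]_d).
move=> /(_ (fun t => 0 < t -> A t)); rewrite mxE => /(_ A0) nA.
change (nbhs (0 : 'cV[R]_d) (fun h => pos_orthant h -> A (h j 0))).
have {}nA : nbhs (0 : 'cV[R]_d) (fun h => 0 < h j 0 -> A (h j 0)) by exact: nA.
by apply: filterS nA => h Ah h0; exact: (Ah (h0 j)).
Qed.

Lemma cvg_comp_coord d (j : 'I_d) (f : R -> R) (r : R) :
  f t @[t --> 0^'+] --> r ->
  (fun h : 'cV[R]_d => f (h j 0)) @ within pos_orthant (nbhs (0 : 'cV[R]_d))
    --> r.
Proof. by move=> fr; apply: cvg_comp fr; exact: cvg_coord_pos_orthant. Qed.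

Lemma a_tilde_cvg0 (x : R) : 0 <= x -> a_tilde x h @[h --> 0^'+] --> 0.
Proof.
rewrite le_eqVlt => /predU1P[<-|x0].
  apply: (@cvg_trans _ (h @[h --> (0 : R)^'+])).
    apply: near_eq_cvg; near=> h.
    have h0 : 0 < h by near: h; exact: nbhs_right_gt.
    rewrite /a_tilde indicE mem_set/=; last by rewrite in_itv/= lexx mulr_gt0.
    by field; rewrite gt_eqF.
  exact: cvg_at_right_filter.
apply: cvg_near_cst; near=> h.
rewrite /a_tilde indicE memNset ?mulr0//= in_itv/= (ltW x0)/=.
apply/negP; rewrite -leNgt -ler_pdivlMl//.
by rewrite ltW//; near: h; apply: nbhs_right_lt; rewrite mulr_gt0.
Unshelve. all: by end_near. Qed.

Lemma b_tilde_cvg0 (x : R) : 0 <= x -> b_tilde x h @[h --> 0^'+] --> 0.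
Proof.
rewrite le_eqVlt => /predU1P[<-|x0].
  apply: (@cvg_trans _ (h * h @[h --> (0 : R)^'+])).
    apply: near_eq_cvg; near=> h.
    have h0 : 0 < h by near: h; exact: nbhs_right_gt.
    by rewrite /b_tilde ifT; [field | rewrite mulr_ge0// ltW].
  have H : h * h @[h --> (0 : R)] --> (0 * 0 : R) by apply: cvgM; exact: cvg_id.
  by rewrite mul0r in H; exact: cvg_at_right_filter.
apply: (@cvg_trans _ (x * h @[h --> (0 : R)^'+])).
  apply: near_eq_cvg; near=> h; rewrite /b_tilde ifF//.
  apply/negP/negP; rewrite -ltNge -ltr_pdivlMl//.
  by near: h; apply: nbhs_right_lt; rewrite mulr_gt0.
have H : x * h @[h --> (0 : R)] --> x * 0 by apply: cvgMr; exact: cvg_id.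
by rewrite mulr0 in H; exact: cvg_at_right_filter.
Unshelve. all: by end_near. Qed.

Lemma standard_variance_cvg0 (x : R) : h * (x + h) @[h --> 0^'+] --> (0 : R).
Proof.
have H : h * (x + h) @[h --> (0 : R)] --> 0 * (x + 0).
  apply: cvgM; first exact: cvg_id.
  by apply: cvgD; [exact: cvg_cst|exact: cvg_id].
by rewrite mul0r in H; exact: cvg_at_right_filter.
Qed.

(** Adding the same small [t > 0] to all coordinates enters the open orthant. The kernel is sure to
    be positive only there, as it may vanish on the faces, so its support is reached through this
    closure. *)
Lemma nonneg_orthant_closure d (u : 'cV[R]_d) :
  nonneg_orthant u -> closure pos_orthant u.
Proof.
move=> u0 V uV.
have : (u + t *: const_mx 1) @[t --> 0^'+] --> u.
  apply: cvg_mx => i j; rewrite ord1.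
  under eq_fun do rewrite !mxE mulr1.
  have H : u i 0 + t @[t --> (0 : R)] --> u i 0 + 0.
    by apply: cvgD; [exact: cvg_cst|exact: cvg_id].
  by rewrite addr0 in H; exact: cvg_at_right_filter.
move=> /(_ V uV) uVt.
have [t [Vt t0]] : exists t : R, V (u + t *: const_mx 1) /\ 0 < t.
  near (0 : R)^'+ => t; exists t; split; near: t => //; exact: nbhs_right_gt.
by exists (u + t *: const_mx 1); split => // j; rewrite !mxE mulr1 ltr_wpDl.
Unshelve. all: by end_near. Qed.

Lemma measurable_nonneg_orthant d : measurable (@nonneg_orthant R d).
Proof.
rewrite (_ : nonneg_orthant =
    \bigcap_(j in [set: 'I_d]) (fun u : 'cV[R]_d => u j 0) @^-1` `[0, +oo[).
  apply: fin_bigcap_measurable => // j _.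
  by rewrite -[X in measurable X]setTI; exact: measurable_coord.
apply/seteqP; split => u /= u0 j; first by move=> _; rewrite /= in_itv/= u0.
by have := u0 j I; rewrite /= in_itv/= andbT.
Qed.

End limits.

(** * The combined kernel as a product of gamma densities *)

Section combined_kernel.
Context {R : realType} (d l : nat).
Implicit Types x h u : 'cV[R]_d.

Definition gamma_shape x h (j : 'I_d) : R :=
  if (j < d - l)%N then 1 + x j 0 / h j 0 else rho (x j 0) (h j 0).

Lemma gamma_shape_ge1 x h j :
  nonneg_orthant x -> pos_orthant h -> 1 <= gamma_shape x h j.
Proof.
move=> x0 h0; rewrite /gamma_shape; case: ifP => _; last exact: rho_ge1.
by rewrite lerDl divr_ge0// ltW.
Qed.

Lemma combined_gamma_kernelE x h :
  combined_gamma_kernel l x h =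
  (fun u => \prod_j gamma_pdf (gamma_shape x h j) (h j 0) (u j 0)).
Proof.
apply/funext => u; rewrite [RHS](bigID (fun j : 'I_d => (j < d - l)%N))/=.
congr (_ * _).
  by apply: eq_bigr => j jl; rewrite gamma_kernelE /gamma_shape jl.
apply: eq_big => [j|j jl]; first by rewrite -leqNgt.
by rewrite modified_gamma_kernelE /gamma_shape ltnNge jl.
Qed.

Lemma is_pdf_on_combined_gamma_kernel x h :
  nonneg_orthant x -> pos_orthant h ->
  is_pdf_on nonneg_orthant (combined_gamma_kernel l x h).
Proof.
move=> x0 h0; rewrite combined_gamma_kernelE.
have s1 j : 1 <= gamma_shape x h j by exact: gamma_shape_ge1.
split.
- exact: measurable_nonneg_orthant.
- apply: (measurable_fun_prod_coord
    (g := fun j => gamma_pdf (gamma_shape x h j) (h j 0))) => j.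
  exact: measurable_gamma_pdf.
- by move=> u; apply: prodr_ge0 => j _; exact: gamma_pdf_ge0.
- split.
    move=> u /existsNP[j /negP]; rewrite -ltNge => uj.
    by rewrite (bigD1 j)//= gamma_pdf_lt0// mul0r.
  move=> u /nonneg_orthant_closure; apply: closure_subset => {}u u0 /=.
  by rewrite gt_eqF// prodr_gt0// => j _; exact: gamma_pdf_gt0.
- rewrite (integral_lebesgue_colvec_prod (c := fun=> 1)
    (g := fun j => gamma_pdf (gamma_shape x h j) (h j 0))).
  + by rewrite big1.
  + by move=> j; exact: measurable_gamma_pdf.
  + by move=> j t; exact: gamma_pdf_ge0.
  + move=> j; have := integral_gamma_pdf 0 (s1 j) (h0 j).
    by under eq_integral do rewrite expr0 mul1r; rewrite big_ord0 mulr1.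
Qed.

Lemma rho_mean (x h : R) : 0 <= x -> 0 < h -> h * rho x h = x + a_tilde x h.
Proof.
move=> x0 h0; rewrite /rho /a_tilde indicE; case: ltP => xh.
  by rewrite mem_set/= ?in_itv/= ?x0// mulr1; field; rewrite gt_eqF.
rewrite memNset ?mulr0 ?addr0; last by rewrite /= in_itv/= x0/= ltNge xh.
by field; rewrite gt_eqF.
Qed.

(** The case [x = 2 * h] stands apart because [rho] and [b_tilde] put it in opposite branches; both
    sides equal [2 * h ^+ 2] there. *)
Lemma rho_variance (x h : R) : 0 < h -> h ^+ 2 * rho x h = b_tilde x h.
Proof.
move=> h0; rewrite /rho /b_tilde; case: (ltgtP x (2 * h)) => [xh|xh|->].
- by field; rewrite gt_eqF.
- by field; rewrite gt_eqF.
- by field; rewrite gt_eqF.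
Qed.

Lemma combined_gamma_kernel_moments x h (disp : measure_display)
    (T : measurableType disp) (P : probability T R) (X : {RV P >-> 'cV[R]_d}) :
  nonneg_orthant x -> pos_orthant h ->
  has_pdf X (combined_gamma_kernel l x h) ->
  has_mean X (\col_j (h j 0 * gamma_shape x h j)) /\
  has_covariance_matrix X (diag_mx (\row_j (h j 0 ^+ 2 * gamma_shape x h j))).
Proof.
move=> x0 h0; rewrite combined_gamma_kernelE => Xk.
have s1 j : 1 <= gamma_shape x h j by exact: gamma_shape_ge1.
pose k j := gamma_pdf (gamma_shape x h j) (h j 0).
pose m j n := h j 0 ^+ n * \prod_(i < n) (gamma_shape x h j + i%:R).
have mk j : measurable_fun setT (k j) by exact: measurable_gamma_pdf.
have k0 j t : 0 <= k j t by exact: gamma_pdf_ge0.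
have k_lt0 j t : t < 0 -> k j t = 0 by exact: gamma_pdf_lt0.
have mE j n := integral_gamma_pdf n (s1 j) (h0 j).
have m0 j : m j 0 = 1 by rewrite /m big_ord0 mulr1.
have -> : \col_j (h j 0 * gamma_shape x h j) = \col_j m j 1%N.
  by apply/colP => j; rewrite !mxE /m big_ord1 addr0 expr1.
(* With shape [a], the second moment is [h ^+ 2 * a * (a + 1)]; subtracting the square of [h * a]
   leaves [h ^+ 2 * a]. *)
have -> : \row_j (h j 0 ^+ 2 * gamma_shape x h j) =
    \row_j (m j 2 - m j 1%N ^+ 2).
  apply/rowP => j; rewrite !mxE /m big_ord1 big_ord_recl big_ord1 /= /bump /=.
  ring.
split.
  exact: (has_mean_product_density mk k0 k_lt0 mE m0 Xk).
exact: (has_covariance_matrix_product_density mk k0 k_lt0 mE m0 Xk).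
Qed.

End combined_kernel.

Theorem proposition1 (R : realType) (d l : nat) (d_ge1 : (1 <= d)%N)
    (l_le_d : (l <= d)%N) :
  exists a b : 'I_d -> R -> R -> R,
    let A (x h : 'cV[R]_d) : 'cV[R]_d := \col_j a j (x j 0) (h j 0) in
    let B (x h : 'cV[R]_d) : 'M[R]_d :=
      diag_mx (\row_j b j (x j 0) (h j 0)) in
    associated_kernel_with (fun _ _ => nonneg_orthant)
      (@combined_gamma_kernel R d l) A B /\
    forall x h : 'cV[R]_d, nonneg_orthant x -> pos_orthant h ->
      [/\ l = 0%N ->
            A x h = \col_j h j 0 /\
            B x h = diag_mx (\row_j (h j 0 * (x j 0 + h j 0))),
          l = d ->
            A x h = \col_j a_tilde (x j 0) (h j 0) /\
            B x h = diag_mx (\row_j b_tilde (x j 0) (h j 0)) &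
          (0 < l < d)%N ->
            A x h = \col_j (if (j < d - l)%N then h j 0
                            else a_tilde (x j 0) (h j 0)) /\
            B x h = diag_mx (\row_j (if (j < d - l)%N
                                     then h j 0 * (x j 0 + h j 0)
                                     else b_tilde (x j 0) (h j 0)))].
Proof.
(* One pair of witnesses covers the three cases: the test on [j] always succeeds for [l = 0], always
   fails for [l = d], and is the stated one in between. *)
exists (fun j x h => if (j < d - l)%N then h else a_tilde x h).
exists (fun j x h => if (j < d - l)%N then h * (x + h) else b_tilde x h).
move=> A B; split; last first.
  move=> x h x0 h0; split => [l0|ld|_] //; rewrite /A /B; split.
  - by apply/colP => j; rewrite !mxE l0 subn0 ltn_ord.
  - by congr diag_mx; apply/rowP => j; rewrite !mxE l0 subn0 ltn_ord.
  - by apply/colP => j; rewrite !mxE ld subnn.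
  - by congr diag_mx; apply/rowP => j; rewrite !mxE ld subnn.
split=> [x h x0 h0|x x0].
  split=> //; first exact: is_pdf_on_combined_gamma_kernel.
  move=> disp T P X Xk.
  have -> : x + A x h = \col_j (h j 0 * gamma_shape l x h j).
    apply/colP => j; rewrite !mxE /gamma_shape; case: ifP => _.
      by field; rewrite gt_eqF.
    by rewrite rho_mean.
  have -> : B x h = diag_mx (\row_j (h j 0 ^+ 2 * gamma_shape l x h j)).
    congr diag_mx; apply/rowP => j; rewrite !mxE /gamma_shape; case: ifP => _.
      by field; rewrite gt_eqF.
    by rewrite rho_variance.
  exact: combined_gamma_kernel_moments.
split; apply: cvg_mx => i j; rewrite mxE.
  under eq_fun do rewrite mxE.
  apply: (@cvg_comp_coord R d i
    (fun t => if (i < d - l)%N then t else a_tilde (x i 0) t)).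
  case: (i < d - l)%N; last exact: a_tilde_cvg0.
  exact: cvg_at_right_filter.
under eq_fun do rewrite !mxE.
(* Off-diagonal entries are constantly 0; only the variances have a limit to compute. *)
case: eqVneq => [_|_]; last by under eq_fun do rewrite mulr0n; exact: cvg_cst.
under eq_fun do rewrite mulr1n.
apply: (@cvg_comp_coord R d i
  (fun t => if (i < d - l)%N then t * (x i 0 + t) else b_tilde (x i 0) t)).
case: (i < d - l)%N; [exact: standard_variance_cvg0|exact: b_tilde_cvg0].
Qed.
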